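(* If $g\in GL(2,\mathbb{Z}[i])$ is of finite order $r$ and $\det(g)=-i$, then $$\mathrm{tr}(g)\in\{0,\pm(1-i)\},\qquad r\in\{4,8\}.$$ More precisely, for the eigenvalues $\lambda_1,\lambda_2$ of $g$ (up to a transposition): (i) $\mathrm{tr}(g)=0$ or, equivalently, $\lambda_1=e^{\frac{\pi i}{4}}$, $\lambda_2=e^{\frac{5\pi i}{4}}$, if and only if $g$ is of order $8$; (ii) if $\mathrm{tr}(g)=1-i$ or, equivalently, $\lambda_1=-i$, $\lambda_2=1$, then $g$ is of order $4$; (iii) if $\mathrm{tr}(g)=-1+i$ or, equivalently, $\lambda_1=i$, $\lambda_2=-1$, then $g$ is of order $4$.
   Context: $GL(2,\mathbb{Z}[i])$ is the group of $2\times2$ matrices over the Gaussian integers $\mathbb{Z}[i]$ with determinant in $\mathbb{Z}[i]^*=\{\pm1,\pm i\}$. *)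

(* Defs.v *)
From mathcomp Require Import all_boot all_order all_algebra.
From mathcomp Require Import reals trigo.
From mathcomp Require Export complex.

Set Implicit Arguments.
Unset Strict Implicit.
Unset Printing Implicit Defensive.

Import Order.TTheory GRing.Theory Num.Theory.
Local Open Scope ring_scope.
Local Open Scope complex_scope.

Definition gaussInt {R : realType} : {pred R[i]} :=
  [pred z | (complex.Re z \is a Num.int) && (complex.Im z \is a Num.int)].

(* GL(2, Z[i]), as a set of complex matrices: Z[i]^* = {1, -1, i, -i}. *)
Definition GL2Zi {R : realType} : {pred 'M[R[i]]_2} :=
  [pred g | (g \is a mxOver (@gaussInt R))
            && (\det g \in [:: 1; -1; 'i%C; - 'i%C])].

(* e^(i t), by Euler's formula. *)
Definition expi {R : realType} (t : R) : R[i] := cos t +i* sin t.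

(* [r.-primitive_root] makes sense in any ring, where it says that r is the
   multiplicative order of x (see has_orderP). *)
Definition has_order (A : nzRingType) (x : A) (r : nat) : Prop :=
  r.-primitive_root x.

Lemma has_orderP (A : nzRingType) (x : A) (r : nat) :
  has_order x r <->
  [/\ (0 < r)%N, x ^+ r = 1 & forall m, (0 < m < r)%N -> x ^+ m <> 1].
Proof.
rewrite /has_order; split=> [xr | [r_gt0 xr1 xm]].
  split; [exact: prim_order_gt0 xr | exact: prim_expr_order |].
  move=> m /andP[m_gt0 ltmr] /eqP; rewrite -(prim_order_dvd xr) => /dvdn_leq.
  by move=> /(_ m_gt0); rewrite leqNgt ltmr.
have [m xm_prim m_dvd] := prim_order_exists r_gt0 xr1.
have m_gt0 := prim_order_gt0 xm_prim.
have := dvdn_leq r_gt0 m_dvd; rewrite leq_eqVlt => /orP[/eqP<- //|ltmr].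
by case: (xm m); rewrite ?m_gt0 ?ltmr ?(prim_expr_order xm_prim).
Qed.

(* The eigenvalues of g, counted with algebraic multiplicity, are l1 and l2 in
   some order; the right-hand side is symmetric in l1 and l2. *)
Definition eigenvalues_are (F : fieldType) (g : 'M[F]_2) (l1 l2 : F) : Prop :=
  char_poly g = ('X - l1%:P) * ('X - l2%:P).

(* Main.v *)
Require Import Defs.
From mathcomp Require Import all_boot all_order all_algebra.
From mathcomp Require Import reals trigo.
From mathcomp Require Import zify ring lra.

(** The trace t and the determinant d = -i determine the characteristic
    polynomial X^2 - t X + d of g, hence its two eigenvalues, so all the claims
    about eigenvalues amount to computing a sum and a product
    ([eigenvalues_are2P], [expi_pi4_5pi4]).

    Since g has finite order, its eigenvalues l1 and l2 are roots of unity
    ([finite_order_eigenvalues2]).  Complex conjugation inverts them, so that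
    conj t = 1/l1 + 1/l2 = t / d, and |t| <= 2.  With d = -i the first relation
    puts t on the line spanned by 1 - i; as t is a Gaussian integer,
    t = a (1 - i) with a an integer, and |t|^2 = 2 a^2 <= 4 leaves only
    a = 0, 1, -1 ([gaussInt_trace_det_Ni]).

    The order r is a multiple of 4 because -i has order 4 and (-i)^r = det g^r = 1
    ([order_dvd4]).  By Cayley-Hamilton, used for g and then for g^2, g^4 is a
    combination of g and 1 with coefficients depending only on t
    ([expr4_det_Ni]): it is -1 when t = 0, whence r = 8, and it is 1 when
    t = 1 - i or t = -1 + i, where t^2 = -2i, whence r = 4. *)

Set Implicit Arguments.
Unset Strict Implicit.
Unset Printing Implicit Defensive.

Import Order.TTheory GRing.Theory Num.Theory.
Local Open Scope ring_scope.

Lemma char_poly2 (A : comNzRingType) (g : 'M[A]_2) :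
  char_poly g = 'X^2 - \tr g *: 'X + (\det g)%:P.
Proof.
have c0 := char_poly_det g; have c1 := char_poly_trace g isT.
have := char_poly_monic g; rewrite monicE lead_coefE.
have := size_char_poly g; move: (char_poly g) c0 c1 => p c0 c1 sz_p.
rewrite sz_p => /eqP c2; apply/polyP => -[|[|[|k]]]; rewrite !coefE /=.
- by rewrite c0 sqrrN expr1n mul1r mulr0 subr0 add0r.
- by rewrite c1 mulr1 addr0 sub0r.
- by rewrite c2 mulr0 subr0 addr0.
- by rewrite nth_default ?sz_p // mulr0 subr0 addr0.
Qed.

(** Cayley-Hamilton in dimension 2, as a reduction rule for powers of g. *)
Lemma sqrmx2 (A : comNzRingType) (g : 'M[A]_2) :
  g ^+ 2 = \tr g *: g - (\det g)%:M.
Proof.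
have := Cayley_Hamilton g.
rewrite char_poly2 rmorphD rmorphB /= linearZ /= rmorphXn /= horner_mx_X.
rewrite horner_mx_C => /eqP; rewrite addr_eq0 subr_eq => /eqP ->.
by rewrite addrC.
Qed.

Lemma det_mxX (A : comNzRingType) n (g : 'M[A]_n.+1) k :
  \det (g ^+ k) = \det g ^+ k.
Proof.
by elim: k => [|k IHk]; rewrite ?expr0 ?det1 // !exprS -IHk -det_mulmx.
Qed.

Lemma mxtrace_sqrmx2 (A : comNzRingType) (g : 'M[A]_2) :
  \tr (g ^+ 2) = \tr g ^+ 2 - \det g *+ 2.
Proof. by rewrite sqrmx2 raddfB /= linearZ /= mxtrace_scalar. Qed.

(** Vieta: both sides of the defining equation are monic of degree 2, so only
    the coefficients of degrees 1 and 0 have to be compared. *)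
Lemma eigenvalues_are2P (F : fieldType) (g : 'M[F]_2) (l1 l2 : F) :
  eigenvalues_are g l1 l2 <-> \tr g = l1 + l2 /\ \det g = l1 * l2.
Proof.
have prodE : ('X - l1%:P) * ('X - l2%:P)
           = 'X^2 - (l1 + l2) *: 'X + (l1 * l2)%:P :> {poly F}.
  by rewrite -mul_polyC polyCD polyCM; ring.
rewrite /eigenvalues_are char_poly2 prodE; split=> [eq_p | [-> ->] //].
split.
- by have := congr1 (fun p : {poly F} => p`_1) eq_p; rewrite !coefE /=
    !mulr1 !addr0 !sub0r => /oppr_inj.
- by have := congr1 (fun p : {poly F} => p`_0) eq_p; rewrite !coefE /=
    !mulr0 !subr0 !add0r.
Qed.

Lemma exists_eigenvalues2 (F : closedFieldType) (g : 'M[F]_2) :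
  exists l1 l2, eigenvalues_are g l1 l2.
Proof.
have [s] := closed_field_poly_normal (char_poly g).
rewrite (monicP (char_poly_monic g)) scale1r => def_p.
have := size_char_poly g; rewrite def_p size_prod_XsubC => -[].
case: s def_p => [|l1 [|l2 [|? ?]]] // def_p _; exists l1, l2.
by rewrite /eigenvalues_are def_p !big_cons big_nil mulr1.
Qed.

Lemma eigenvalue_expr_eq1 (F : fieldType) (n r : nat) (g : 'M[F]_n.+1) (l : F) :
  g ^+ r = 1 -> eigenvalue g l -> l ^+ r = 1.
Proof.
move=> gr1 /eigenvalueP[v vg v_neq0].
have vgX k : v *m g ^+ k = l ^+ k *: v.
  elim: k => [|k IHk]; first by rewrite !expr0 mulmx1 scale1r.
  by rewrite !exprS mulmxA vg -scalemxAl IHk scalerA.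
apply/eqP; rewrite -subr_eq0; apply: contraNT v_neq0 => lr.
have /eqP := vgX r; rewrite gr1 mulmx1 eq_sym -subr_eq0.
by rewrite -{2}[v]scale1r -scalerBl scaler_eq0 (negPf lr).
Qed.

(** An eigenvector of g is one of g^r = 1, so the eigenvalues are roots of
    unity; only their absolute value matters for the trace. *)
Lemma finite_order_eigenvalues2 (C : numClosedFieldType) (r : nat) (g : 'M[C]_2) :
  (0 < r)%N -> g ^+ r = 1 ->
  exists l1 l2, [/\ eigenvalues_are g l1 l2, `|l1| = 1 & `|l2| = 1].
Proof.
move=> r_gt0 gr1; have [l1 [l2 def_g]] := exists_eigenvalues2 g.
have norm1 l : root (char_poly g) l -> `|l| = 1.
  rewrite -eigenvalue_root_char => /(eigenvalue_expr_eq1 gr1) lr1.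
  by apply/eqP; rewrite -(pexpr_eq1 r_gt0) // -normrX lr1 normr1.
by exists l1, l2; split=> //; apply: norm1;
  rewrite def_g rootM !root_XsubC eqxx ?orbT.
Qed.

Lemma finite_order_trace2_norm (C : numClosedFieldType) (r : nat) (g : 'M[C]_2) :
  (0 < r)%N -> g ^+ r = 1 -> `|\tr g| <= 2.
Proof.
move=> r_gt0 /(finite_order_eigenvalues2 r_gt0).
move=> [l1 [l2 [/eigenvalues_are2P[-> _] n1 n2]]].
by rewrite (le_trans (ler_normD _ _)) // n1 n2.
Qed.

(** On the unit circle conjugation is inversion, so conjugating l1 + l2 gives
    1/l1 + 1/l2 = (l1 + l2) / (l1 l2). *)
Lemma finite_order_trace2_conj (C : numClosedFieldType) (r : nat) (g : 'M[C]_2) :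
  (0 < r)%N -> g ^+ r = 1 -> \det g * (\tr g)^* = \tr g.
Proof.
move=> r_gt0 /(finite_order_eigenvalues2 r_gt0).
move=> [l1 [l2 [/eigenvalues_are2P[-> ->] n1 n2]]].
have unit_conj (l : C) : `|l| = 1 -> l * l^* = 1.
  by rewrite -normCK => ->; rewrite expr1n.
rewrite rmorphD /= mulrDr addrC -mulrA unit_conj // mulr1.
by rewrite mulrAC unit_conj // mul1r.
Qed.

Local Open Scope complex_scope.

Lemma trace_gaussInt (R : realType) n (g : 'M[R[i]]_n) :
  g \is a mxOver (@gaussInt R) -> \tr g \in gaussInt.
Proof.
move=> /mxOverP g_int; rewrite /mxtrace; elim/big_ind: _ => [|x y|i _] //.
  by rewrite inE /= rpred0.
by rewrite !inE; case: x y => [a b] [c d] /= /andP[? ?] /andP[? ?]; rewrite !rpredD.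
Qed.

Lemma intr_sqr_le2 (R : realType) (a : R) :
  a \is a Num.int -> a ^+ 2 <= 2 -> a \in [:: 0; 1; -1].
Proof.
move=> /intrP[m ->]; rewrite -rmorphXn -[2]/(2%:~R) ler_int => m2.
have : m \in [:: 0; 1; -1] by rewrite !inE; nia.
by rewrite !inE => /or3P[]/eqP->; rewrite ?eqxx ?orbT ?mulrN1z ?eqxx ?orbT.
Qed.

(** Writing t = a + b i, the second hypothesis says b = - a, that is
    t = a (1 - i); then |t|^2 = 2 a^2 makes the bound say a^2 <= 2. *)
Lemma gaussInt_trace_det_Ni (R : realType) (t : R[i]) :
  t \in gaussInt -> - 'i * t^* = t -> `|t| <= 2 ->
  t \in [:: 0; 1 - 'i; - (1 - 'i)].
Proof.
case: t => a b; rewrite inE /= => /andP[a_int _] [t_re _] t_norm.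
have def_b : b = - a by lra.
have a2 : a ^+ 2 <= 2.
  move: t_norm; rewrite -ler_sqr ?nnegrE // -add_Re2_Im2 /= def_b.
  rewrite -[2 : R[i]](rmorph_nat (real_complex R)) -rmorphXn lecR /=; lra.
have := intr_sqr_le2 a_int a2.
rewrite def_b !inE !eq_complex /= => /or3P[] /eqP->; apply/or3P;
  [apply: Or31 | apply: Or32 | apply: Or33]; apply/andP; split; apply/eqP; ring.
Qed.

(** The two angles differ by pi, so the second number is the opposite of the
    first, and the product is minus the square of the first, which is
    - e^(i pi / 2) = - i. *)
Lemma expi_pi4_5pi4 (R : realType) :
  (expi (pi / 4) + expi (5 * pi / 4) = 0 :> R[i]) /\
  (expi (pi / 4) * expi (5 * pi / 4) = - 'i :> R[i]).
Proof.
have -> : expi (5 * pi / 4) = - expi (pi / 4) :> R[i].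
  rewrite /expi (_ : 5 * pi / 4 = pi / 4 + pi); last by field.
  by rewrite sinDpi cosDpi.
split; first by rewrite subrr.
have cos2 : cos (pi / 4) ^+ 2 - sin (pi / 4) ^+ 2 = 0 :> R.
  by rewrite !expr2 -cosD -[RHS]cos_pihalf; congr cos; field.
have sin2 : sin (pi / 4) * cos (pi / 4) + cos (pi / 4) * sin (pi / 4) = 1 :> R.
  by rewrite -sinD -[RHS]sin_pihalf; congr sin; field.
by apply/eqP; rewrite eq_complex /=; apply/andP; split; apply/eqP; lra.
Qed.

(** Cayley-Hamilton applied to g^2, whose trace is t^2 + 2i for t the trace of g
    and whose determinant is -1, then to g. *)
Lemma expr4_det_Ni (R : realType) (g : 'M[R[i]]_2) :
  \det g = - 'i ->
  g ^+ 4 = (\tr g * (\tr g ^+ 2 + 'i *+ 2)) *: g + (\tr g ^+ 2 * 'i - 1)%:M.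
Proof.
move=> det_g; have i2 := sqr_i R.
rewrite (exprM g 2 2) sqrmx2 mxtrace_sqrmx2 [in X in _ *: X]sqrmx2 det_g.
rewrite det_mxX det_g sqrrN i2 mulNrn !opprK.
set t := \tr g.
rewrite scalerDr scalerA -addrA [_ * t]mulrC; congr (_ + _).
rewrite -raddfN /= scale_scalar_mx -raddfB /= !opprK; congr _%:M.
by rewrite mulrDl mulrnAl -expr2 i2; ring.
Qed.

(** The determinant maps g to -i, which is a primitive fourth root of unity, so
    its order divides every r with g^r = 1. *)
Lemma order_dvd4 (R : realType) (g : 'M[R[i]]_2) r :
  \det g = - 'i -> g ^+ r = 1 -> (4 %| r)%N.
Proof.
move=> det_g gr1; have i2 := sqr_i R.
have Ni_prim : 4.-primitive_root (- 'i : R[i]).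
  apply/has_orderP; split=> //; first by rewrite (exprM _ 2 2) sqrrN i2 sqrrN expr1n.
  move=> [|[|[|[|m]]]] // _.
  - by move=> [] /eqP; rewrite oppr0 eq_sym oner_eq0.
  - by rewrite sqrrN i2 => /eqP; rewrite eq_sym -addr_eq0 (pnatr_eq0 _ 2).
  - by rewrite exprS sqrrN i2 mulrN1 opprK => -[] /eqP; rewrite eq_sym oner_eq0.
by rewrite (prim_order_dvd Ni_prim) -det_g -det_mxX gr1 det1.
Qed.

Unset Implicit Arguments.
Set Strict Implicit.

Theorem proposition18 (R : realType) (g : 'M[R[i]]_2) (r : nat)
    (g_GL2 : g \in GL2Zi) (g_order : has_order g r) (g_det : \det g = - 'i%C) :
  [/\ \tr g \in [:: 0; 1 - 'i%C; - (1 - 'i%C)],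
      r \in [:: 4; 8]%N,
      (\tr g = 0 <-> eigenvalues_are g (expi (pi / 4)) (expi (5 * pi / 4)))
        /\ (\tr g = 0 <-> r = 8%N),
      (\tr g = 1 - 'i%C <-> eigenvalues_are g (- 'i%C) 1)
        /\ (\tr g = 1 - 'i%C -> r = 4%N)
    & (\tr g = -1 + 'i%C <-> eigenvalues_are g 'i%C (-1))
        /\ (\tr g = -1 + 'i%C -> r = 4%N)].
Proof.
have r_gt0 := prim_order_gt0 g_order; have gr1 := prim_expr_order g_order.
have i2 := sqr_i R.
have tr_in : \tr g \in [:: 0; 1 - 'i; - (1 - 'i)].
  apply: gaussInt_trace_det_Ni; last exact: finite_order_trace2_norm r_gt0 gr1.
    by case/andP: g_GL2 => /trace_gaussInt.
  by rewrite -g_det; exact: finite_order_trace2_conj r_gt0 gr1.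
have r4 := order_dvd4 g_det gr1.
have g4 := expr4_det_Ni g_det.
have r_eq8 : \tr g = 0 -> r = 8%N.
  move=> t0; have {}g4 : g ^+ 4 = - 1.
    by rewrite g4 t0 !mul0r expr0n mul0r scale0r add0r sub0r raddfN.
  have r8 : (r %| 8)%N by rewrite (prim_order_dvd g_order) (exprM g 4 2) g4 sqrrN expr1n.
  (* Among the multiples of 4, only 4 and 8 divide 8, and g ^+ 4 <> 1. *)
  case/dvdnP: r4 r8 gr1 => -[|[|[|k]]] -> //.
  rewrite g4 => _ /matrixP/(_ 0 0)/eqP.
  by rewrite !mxE eq_sym -addr_eq0 (pnatr_eq0 _ 2).
have r_eq4 : \tr g ^+ 2 = - 'i *+ 2 -> r = 4%N.
  move=> t2; have {}g4 : g ^+ 4 = 1.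
    rewrite g4 t2 mulNrn addNr mulr0 scale0r add0r mulNr mulrnAl -expr2 i2.
    by rewrite mulNrn opprK addrK.
  have : (r %| 4)%N by rewrite (prim_order_dvd g_order) g4.
  by move=> /(conj r4)/andP; rewrite -eqn_dvd => /eqP.
have r_eq4_tr : \tr g = 1 - 'i -> r = 4%N.
  by move=> tE; apply: r_eq4; rewrite tE sqrrB i2; ring.
have r_eq4_trN : \tr g = -1 + 'i -> r = 4%N.
  by move=> tE; apply: r_eq4; rewrite tE sqrrD i2; ring.
have [sum_expi prod_expi] := expi_pi4_5pi4 R.
have eigP l1 l2 t : l1 + l2 = t -> l1 * l2 = - 'i ->
    \tr g = t <-> eigenvalues_are g l1 l2.
  move=> <- def_d; rewrite eigenvalues_are2P g_det def_d; tauto.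
split=> //.
- move: tr_in; rewrite !inE => /or3P[]/eqP.
  + by move/r_eq8->.
  + by move/r_eq4_tr->.
  + by rewrite opprB addrC => /r_eq4_trN->.
- split; first exact: eigP.
  split=> [//|r8]; move: tr_in; rewrite !inE => /or3P[]/eqP //.
  + by move/r_eq4_tr; rewrite r8.
  + by rewrite opprB addrC => /r_eq4_trN; rewrite r8.
- split=> //; apply: eigP; first by rewrite addrC.
  by rewrite mulr1.
- by split=> //; apply: eigP; rewrite ?mulrN1 // addrC.
Qed.
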